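(* Let $p\ge 11$ be a prime. Then $$\binom{2p-1}{p-1}\equiv 1-2p\sum_{k=1}^{p-1}\frac{1}{k}+4p^2\sum_{1\le i<j\le p-1}\frac{1}{ij}\pmod{p^7}.$$
   Context: For rational numbers $a,b$ whose denominators are not divisible by the prime $p$, and a positive integer $m$, $a\equiv b\pmod{p^m}$ means that $a-b=p^m c$ for some rational number $c$ whose denominator is not divisible by $p$. *)

(* Defs.v *)
From HB Require Import structures.
From mathcomp Require Import all_boot all_order all_algebra.

Set Implicit Arguments.
Unset Strict Implicit.
Unset Printing Implicit Defensive.

Import Order.TTheory GRing.Theory Num.Theory.
Local Open Scope ring_scope.

(* [denq x] is the positive denominator of [x] in lowest terms. *)
Definition p_integral (p : nat) (x : rat) : bool := ~~ (p%:Z %| denq x)%Z.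

(* The congruence is only defined between p-integral rationals, so this is
   part of the relation. *)
Definition rat_cong (p m : nat) (a b : rat) : Prop :=
  [/\ p_integral p a, p_integral p b &
      exists2 c : rat, p_integral p c & a - b = p%:R ^+ m * c].

(* Main.v *)
(* Let F = prod_{1 <= k < p} (X + k), so that F(p) = (p-1)! C(2p-1, p-1) and
   the coefficients of F of degree 0, 1, 2, divided by F(0) = (p-1)!, are the
   elementary symmetric functions of 1/k occurring in the theorem. Pairing k
   with p - k gives F = G(X (X + p)) for an integer polynomial G, and comparing
   coefficients shows that (p-1)! times the difference of the two sides is
   8 p^6 g3 up to a multiple of p^7, where g3 is the cubic coefficient of G.
   Modulo p, G(X^2) = F = X^(p-1) - 1, hence p divides g3 when p - 1 > 6. *)
Require Import Defs.
From HB Require Import structures.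
From mathcomp Require Import all_boot all_order all_algebra.
From mathcomp Require Import finfield zify ring.

Set Implicit Arguments.
Unset Strict Implicit.
Unset Printing Implicit Defensive.

Import Order.TTheory GRing.Theory Num.Theory.
Local Open Scope ring_scope.

(** The ring is a parameter because the argument moves between the integers (truncation), the
    rationals (sums of reciprocals) and ['F_p] (divisibility of g3). *)
Definition rising (R : comNzRingType) (n : nat) : {poly R} :=
  \prod_(1 <= k < n) ('X + k%:R%:P).

Definition paired (R : comNzRingType) (p h : nat) : {poly R} :=
  \prod_(1 <= k < h.+1) ('X + (k * (p - k))%:R%:P).

Lemma map_rising (R S : comNzRingType) (f : {rmorphism R -> S}) n :
  map_poly f (rising R n) = rising S n.
Proof.
rewrite rmorph_prod; apply: eq_bigr => k _.
by rewrite rmorphD /= map_polyX map_polyC /= rmorph_nat.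
Qed.

Lemma map_paired (R S : comNzRingType) (f : {rmorphism R -> S}) p h :
  map_poly f (paired R p h) = paired S p h.
Proof.
rewrite rmorph_prod; apply: eq_bigr => k _.
by rewrite rmorphD /= map_polyX map_polyC /= rmorph_nat.
Qed.

Lemma risingS (R : comNzRingType) n :
  (0 < n)%N -> rising R n.+1 = rising R n * ('X + n%:R%:P).
Proof. by move=> n_gt0; rewrite /rising big_nat_recr. Qed.

Lemma rising_coef0 (R : comNzRingType) n : (rising R n.+1)`_0 = n`!%:R.
Proof.
rewrite -horner_coef0 horner_prod fact_prod natr_prod.
by apply: eq_bigr => k _; rewrite !hornerE.
Qed.

Lemma rising_coef1 (n : nat) :
  (rising rat n.+1)`_1 = n`!%:R * \sum_(1 <= k < n.+1) 1 / k%:R.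
Proof.
elim: n => [|n IHn]; first by rewrite /rising !big_geq // coef1 mulr0.
rewrite risingS // mulrDr coefD coefMX coefMC /= IHn rising_coef0.
rewrite [in RHS]big_nat_recr //= factS natrM.
have : n.+1%:R != 0 :> rat by rewrite pnatr_eq0.
by move: n.+1%:R => c c_neq0; field.
Qed.

Lemma rising_coef2 (n : nat) :
  (rising rat n.+1)`_2 = n`!%:R *
    \sum_(1 <= i < n.+1) \sum_(i.+1 <= j < n.+1) 1 / (i%:R * j%:R).
Proof.
elim: n => [|n IHn]; first by rewrite /rising !big_geq // coef1 mulr0.
rewrite risingS // mulrDr coefD coefMX coefMC /= IHn rising_coef1.
rewrite [in RHS]big_nat_recr //= [X in _ = _ * (_ + X)]big_geq // addr0 factS natrM.
have -> : \sum_(1 <= i < n.+1) \sum_(i.+1 <= j < n.+2) 1 / (i%:R * j%:R) =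
  \sum_(1 <= i < n.+1) \sum_(i.+1 <= j < n.+1) 1 / (i%:R * j%:R) +
  (\sum_(1 <= i < n.+1) 1 / i%:R) / n.+1%:R :> rat.
  rewrite mulr_suml -big_split /=; apply: eq_big_nat => i /andP[_ i_le].
  by rewrite big_nat_recr //= invfM mulrA.
have : n.+1%:R != 0 :> rat by rewrite pnatr_eq0.
by move: n.+1%:R => c c_neq0; field.
Qed.

Lemma rising_horner (n : nat) :
  (rising int n.+1).[n.+1%:R] = (n`! * 'C(2 * n.+1 - 1, n))%:R.
Proof.
have -> : (n`! * 'C(2 * n.+1 - 1, n) = \prod_(1 <= k < n.+1) (n.+1 + k))%N.
  have -> : (2 * n.+1 - 1 = n + n.+1)%N by lia.
  (* Multiplied by (n+1)!, both sides become (2n+1)!. *)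
  apply/eqP; rewrite -(eqn_pmul2l (fact_gt0 n.+1)); apply/eqP.
  transitivity (n + n.+1)`!.
    by rewrite -(bin_fact (leq_addr n.+1 n)) addKn; ring.
  rewrite (fact_split (leq_addl n n.+1)); congr (_ * _)%N.
  rewrite -[n.+2]add1n big_addn; have -> : ((n + n.+1).+1 - n.+1 = n.+1)%N by lia.
  by apply: eq_bigr => k _; rewrite addnC.
rewrite horner_prod natr_prod; apply: eq_bigr => k _.
by rewrite !hornerE natrD.
Qed.

(* The factors of index [k] and [p - k] multiply to [X (X + p) + k (p - k)]. *)
Lemma rising_paired (R : comNzRingType) (h : nat) :
  rising R h.*2.+1 = paired R h.*2.+1 h \Po ('X * ('X + h.*2.+1%:R%:P)).
Proof.
rewrite /rising (@big_cat_nat _ _ _ h.+1) //=; last by lia.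
rewrite rmorph_prod [X in _ * X]big_nat_rev /=.
rewrite -[X in _ * \prod_(X <= _ < _) _]add1n big_addn.
have -> : (h.*2.+1 - h = h.+1)%N by lia.
rewrite -big_split /=; apply: eq_big_nat => k k_bd.
have -> : (h.+1 + h.*2.+1 - (k + h).+1 = h.*2.+1 - k)%N by lia.
rewrite comp_polyD comp_polyX comp_polyC.
have {2}-> : h.*2.+1 = (k + (h.*2.+1 - k))%N by lia.
by rewrite natrD natrM polyCD polyCM; ring.
Qed.

(** X^p - X is the product of X - x over all x in ['F_p]; replacing x by -x gives the factors X + k,
    and k = 0 supplies the extra X. *)
Lemma rising_Fp (p : nat) : prime p -> 'X * rising 'F_p p = 'X^p - 'X.
Proof.
move=> p_pr.
have := finField_genPoly 'F_p; rewrite card_Fp // => ->.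
rewrite (reindex_inj oppr_inj) /=.
rewrite (eq_bigr (fun x : 'F_p => 'X + ((x : nat)%:R)%:P)); last first.
  by move=> x _; rewrite natr_Zp polyCN opprK.
rewrite -(big_mkord xpredT (fun k => 'X + (k%:R)%:P : {poly 'F_p})).
rewrite (Fp_cast p_pr) big_ltn ?prime_gt0 //.
by rewrite addr0.
Qed.

Lemma paired_coef3 (h : nat) : prime h.*2.+1 -> (3 < h)%N ->
  (h.*2.+1%:Z %| (paired int h.*2.+1 h)`_3)%Z.
Proof.
move=> p_pr h_gt3; set p := h.*2.+1.
rewrite (dvdz_pcharf (pchar_Fp p_pr)) -coef_map (map_paired intr).
(* Modulo p the inner polynomial is X^2, so g3 sits in degree 6 of F, hence in degree 7 of X F. *)
have /(congr1 (fun q : {poly 'F_p} => q`_7)) := rising_Fp p_pr.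
rewrite coefXM /= rising_paired pchar_Fp_0 // addr0 -expr2.
rewrite coef_comp_poly_Xn //= => ->.
rewrite coefB coefXn coefX subr0 (_ : (7 == p)%N = false) //; lia.
Qed.

(** The reduced denominator divides the denominator of any representation, by Gauss's lemma, so no
    fraction has to be put in lowest terms. *)
Lemma p_integral_frac (p : nat) (a : int) (d : nat) :
  coprime p d -> (1 < p)%N -> p_integral p (a%:~R / d%:R).
Proof.
move=> p_d p_gt1; rewrite /p_integral; set x : rat := _ / _.
have d_neq0 : d%:R != 0 :> rat.
  rewrite pnatr_eq0; apply: contraTneq p_d => ->.
  by rewrite /coprime gcdn0; lia.
have num_den : numq x * d%:Z = a * denq x.
  apply/eqP; rewrite -(eqr_int rat) !rmorphM /=; apply/eqP.
  have den_neq0 : (denq x)%:~R != 0 :> rat by rewrite intr_eq0 denq_neq0.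
  apply: (mulIf (invr_neq0 den_neq0)); rewrite mulfK // mulrAC divq_num_den.
  by rewrite /x -pmulrn mulfVK.
have den_d : (denq x %| d%:Z)%Z.
  rewrite -(@Gauss_dvdzr _ (numq x)); last first.
    by rewrite coprimezE coprime_sym coprime_num_den.
  by rewrite num_den dvdz_mull.
apply: contraTN p_d => /dvdz_trans /(_ den_d) p_dvd.
have {}p_dvd : (p %| d)%N by [].
by rewrite /coprime (gcdn_idPl p_dvd); lia.
Qed.

(* With [Y = X (X + c)] and [f = g0 + g1 Y + g2 Y^2 + ...], one has [f0 = g0],
   [f1 = c g1] and [f2 = g1 + c^2 g2], whereas [Y = 2 c^2] at [X = c]. *)
Lemma paired_truncation (R : comNzRingType) (g : {poly R}) (c : R) :
  let f := g \Po ('X * ('X + c%:P)) in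
  exists r : R, f.[c] = f`_0 - 2 * c * f`_1 + 4 * c ^+ 2 * f`_2
                 + 8 * c ^+ 6 * g`_3 + c ^+ 7 * r.
Proof.
move=> f; pose r := drop_poly 4 g.
(* Horner form in Y, with a factor X exposed at each level so that low coefficients can be peeled
   off by [coefXM]. *)
have f_def : f = (g`_0)%:P + 'X * (('X + c%:P) * ((g`_1)%:P + 'X * (('X + c%:P) *
    ((g`_2)%:P + ('X * ('X + c%:P)) * ((g`_3)%:P + 'X * ('X + c%:P) *
      (r \Po ('X * ('X + c%:P)))))))).
  rewrite /f -{1}[g](poly_take_drop 4 g) comp_polyD comp_polyM.
  rewrite /take_poly poly_def !big_ord_recr big_ord0 /=.
  rewrite !comp_polyD comp_poly0 !comp_polyZ !comp_Xn_poly -!mul_polyC -/r; ring.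
(* The tail is Y^4 r(Y), and Y^4 = 16 c^8 at X = c. *)
exists (16 * c * (r \Po ('X * ('X + c%:P))).[c]).
have -> : f`_0 = g`_0 by rewrite f_def coefD coefC coefXM /= addr0.
have -> : f`_1 = c * g`_1.
  rewrite f_def coefD coefC coefXM /= add0r -!horner_coef0 !hornerE; ring.
have -> : f`_2 = g`_1 + c ^+ 2 * g`_2.
  rewrite f_def coefD coefC coefXM /= add0r mulrDl coefD coefXM coefCM /=.
  rewrite !coefD !coefC !coefXM /= -!horner_coef0.
  by rewrite !(hornerD, hornerM, hornerX, hornerC); ring.
rewrite f_def !(hornerD, hornerM, hornerX, hornerC); ring.
Qed.

Theorem theorem1p1 (p : nat) (p_prime : prime p) (p_ge11 : (11 <= p)%N) :
  rat_cong p 7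
    ('C(2 * p - 1, p - 1))%:R
    (1 - 2%:R * p%:R * (\sum_(1 <= k < p) 1 / k%:R)
       + 4%:R * p%:R ^+ 2 *
         (\sum_(1 <= i < p) \sum_(i.+1 <= j < p) 1 / (i%:R * j%:R))).
Proof.
pose h := p./2.
have p_def : p = h.*2.+1.
  have [|p_odd] := even_prime p_prime; first by lia.
  by rewrite -[LHS]odd_double_half p_odd.
pose D := p.-1`!.
have p_D : coprime p D.
  (* By Wilson, p divides (p-1)! + 1, so it cannot divide (p-1)! as well. *)
  rewrite prime_coprime //; apply/negP => p_dvd.
  have := p_prime; rewrite Wilson ?prime_gt1 // -addn1 dvdn_addr //.
  by rewrite dvdn1; lia.
have D_neq0 : D%:R != 0 :> rat by rewrite pnatr_eq0 -lt0n fact_gt0.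
have p_gt1 := prime_gt1 p_prime.
have p_S : p = p.-1.+1 by lia.
have [c3 c3P] : exists c3, (paired int p h)`_3 = p%:Z * c3.
  have /dvdzP[c3 ->] : (p%:Z %| (paired int p h)`_3)%Z.
    by rewrite p_def; apply: paired_coef3; [rewrite -p_def|lia].
  by exists c3; rewrite mulrC.
have [r] := paired_truncation (paired int p h) p%:R.
have <- : rising int p = paired int p h \Po ('X * ('X + p%:R%:P)).
  by rewrite p_def rising_paired.
rewrite c3P.
rewrite [in X in X = _]p_S rising_horner -p_S => trunc.
have coefq i : (rising rat p)`_i = ((rising int p)`_i)%:~R.
  by rewrite -coef_map map_rising.
have := coefq 0; have := coefq 1; have := coefq 2.
rewrite p_S rising_coef0 rising_coef1 rising_coef2 -p_S -/D.
set T := \sum_(_ <= _ < _) _; set H := \sum_(_ <= _ < _) _ => E2 E1 E0.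
have -> : (p - 1 = p.-1)%N by lia.
set B := 'C(_, _) in trunc *.
(* With g3 = p c3, the cubic term 8 p^6 g3 merges with p^7 r; dividing by (p-1)! gives the
   witness. *)
have diff : B%:R - (1 - 2 * p%:R * H + 4 * p%:R ^+ 2 * T) =
    p%:R ^+ 7 * ((8 * c3 + r)%:~R / D%:R) :> rat.
  apply: (mulfI D_neq0).
  rewrite -/D in trunc.
  rewrite mulrBr [RHS]mulrCA [D%:R * (_ / D%:R)]mulrC divfK // -natrM.
  have := congr1 (intr : int -> rat) trunc.
  rewrite !(rmorphD, rmorphM, rmorphXn, rmorphN, rmorph_nat) /= -E0 -E1 -E2.
  by rewrite -!pmulrn => ->; ring.
have B_int : p_integral p B%:R.
  by have := @p_integral_frac p B 1 (coprimen1 p) p_gt1; rewrite divr1.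
have c_int := p_integral_frac (8 * c3 + r) p_D p_gt1.
split=> //; last by exists ((8 * c3 + r)%:~R / D%:R).
(* The p-integrality of the right-hand side is read off from [diff], which makes it a fraction over
   [D], without examining the sums. *)
have -> : 1 - 2 * p%:R * H + 4 * p%:R ^+ 2 * T =
    (B%:Z * D%:Z - p%:Z ^+ 7 * (8 * c3 + r))%:~R / D%:R :> rat.
  apply: (mulIf D_neq0); rewrite divfK // rmorphB 2!rmorphM rmorphXn /= -!pmulrn.
  rewrite -[in RHS](@divfK _ D%:R D_neq0 (8 * c3 + r)%:~R).
  rewrite [in RHS]mulrA -diff; ring.
exact: p_integral_frac.
Qed.
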